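(* When $\beta=0$, all the distinct ideals of the ring $\mathcal{K}_j$ are as listed below. Type I (trivial ideals): $\{0\}$, $\mathcal{K}_j$. Type II (principal ideals with non-monic polynomial generators): $\langle\gamma f_j(x)^\tau\rangle$, where $0\le\tau<p^s$. Type III (principal ideals with monic polynomial generators): $\langle f_j(x)^\omega+\gamma f_j(x)^tG(x)\rangle$, where $0<\omega<p^s$, $0\le t<\kappa$ if $G(x)\neq0$, and $G(x)$ is either $0$ or a unit in $\mathcal{K}_j$ of the form $\sum_{i=0}^{\kappa-t-1}a_i(x)f_j(x)^i$ with $a_i(x)\in\mathcal{P}_{d_j}(\mathcal{T}_2)$ for $0\le i\le\kappa-t-1$. Here $\kappa$ is the smallest integer satisfying $0\le\kappa\le\omega$ and $\gamma f_j(x)^\kappa\in\langle f_j(x)^\omega+\gamma f_j(x)^tG(x)\rangle$. Type IV (non-principal ideals): $\langle f_j(x)^\omega+\gamma f_j(x)^tG(x),\ \gamma f_j(x)^\mu\rangle$, where $0\le\mu<\kappa\le\omega<p^s$, $0\le t<\mu$ if $G(x)\neq0$, and $G(x)$ is either $0$ or a unit in $\mathcal{K}_j$ of the form $\sum_{i=0}^{\mu-t-1}a_i(x)f_j(x)^i$ with $a_i(x)\in\mathcal{P}_{d_j}(\mathcal{T}_2)$ for $0\le i\le\mu-t-1$, with $\kappa$ the smallest integer satisfying $\gamma f_j(x)^\kappa\in\langle f_j(x)^\omega+\gamma f_j(x)^tG(x)\rangle$.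
   Context: $\mathcal{R}_2$ is a finite commutative chain ring with unity, with maximal ideal $\langle\gamma\rangle$, where $\gamma\neq0$ and $\gamma^2=0$; its residue field has order $p^m$, $p$ prime. $\zeta\in\mathcal{R}_2$ has multiplicative order $p^m-1$ and $\mathcal{T}_2=\{0,1,\zeta,\dots,\zeta^{p^m-2}\}$. $n,s$ are positive integers with $\gcd(n,p)=1$. $\alpha\in\mathcal{T}_2\setminus\{0\}$, $\beta\in\mathcal{T}_2$, $\lambda=\alpha+\gamma\beta$, and $\alpha_0\in\mathcal{T}_2$ satisfies $\alpha_0^{p^s}=\alpha$. Write $x^n-\alpha_0=f_1(x)\cdots f_r(x)$ with $f_j$ monic, pairwise coprime and basic irreducible (irreducible modulo $\gamma$) in $\mathcal{R}_2[x]$, $d_j=\deg f_j$. Then $x^{np^s}-\lambda=\prod_{j=1}^rk_j(x)$ with $k_j(x)=f_j(x)^{p^s}+\gamma g_j(x)$ monic, pairwise coprime, of degree $d_jp^s$, for certain $g_j\in\mathcal{R}_2[x]$ (the $k_j$ are uniquely determined by these properties). Fix $1\le j\le r$ and put $\mathcal{K}_j=\mathcal{R}_2[x]/\langle k_j(x)\rangle$. $\mathcal{P}_{d_j}(\mathcal{T}_2)$ denotes the set of polynomials with all coefficients in $\mathcal{T}_2$ that are either $0$ or of degree less than $d_j$. *)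

(* Defs.v *)
From HB Require Import structures.
From mathcomp Require Import all_boot all_order all_algebra.

Set Implicit Arguments.
Unset Strict Implicit.
Unset Printing Implicit Defensive.

Import GRing.Theory.
Local Open Scope ring_scope.

(* The library gives [{poly %/ h}] its finite type and ring structures, but
   joins them only over a finite field; [qfpoly], which does so, must not be
   imported before this instance. *)
HB.instance Definition _ (R : finComNzRingType) (h : {poly R}) :=
  Finite.on {poly %/ h}.

Section Ideals.
Variable A : finComNzRingType.

(* The library's [idealr_closed] only covers proper ideals. *)
Definition is_ideal (I : {set A}) : Prop :=
  0 \in I /\ (forall a u v : A, u \in I -> v \in I -> a * u + v \in I).

Definition ideal1 (a : A) : {set A} := [set u * a | u : A].

Definition ideal2 (a b : A) : {set A} := [set u * a + v * b | u : A, v : A].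

Definition principal (I : {set A}) : Prop := exists a : A, I = ideal1 a.

Definition maximal_ideal (M : {set A}) : Prop :=
  [/\ is_ideal M, M != setT &
      forall I : {set A}, is_ideal I -> M \subset I -> I = M \/ I = setT].

Definition chain_ring : Prop :=
  forall I J : {set A}, is_ideal I -> is_ideal J ->
    I \subset J \/ J \subset I.

Definition invertible (a : A) : Prop := exists b : A, a * b = 1.

End Ideals.

(* Coprimality over a ring that is not a domain: the two polynomials generate
   the unit ideal. *)
Definition comaximal (R : comNzRingType) (a b : {poly R}) : Prop :=
  exists u v : {poly R}, u * a + v * b = 1.

Definition teich (R : finComNzRingType) (N : nat) (zeta : R) : {set R} :=
  0 |: [set zeta ^+ (i : nat) | i : 'I_N].

(* A label of the list of ideals: [TypeIII omega t G] and
   [TypeIV omega t G mu] carry the parameters of the corresponding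
   generators. *)
Inductive ideal_label (R : finComNzRingType) : Type :=
| TypeI_zero
| TypeI_full
| TypeII of nat
| TypeIII of nat & nat & {poly R}
| TypeIV of nat & nat & {poly R} & nat.

Arguments TypeI_zero {R}.
Arguments TypeI_full {R}.
Arguments TypeII {R}.

Section Listing.
Variables (R : finComNzRingType) (T : {set R}) (gamma : R).
(* [q] stands for p ^ s; the ring is K = R[x] / <k>. When k is monic and
   nonconstant, [{poly %/ k}] is R[x] / <k> and [in_qpoly k] is the canonical
   projection. *)
Variables (q : nat) (f k : {poly R}).

Definition gen2 (tau : nat) : {poly R} := gamma *: f ^+ tau.

Definition gen3 (omega t : nat) (G : {poly R}) : {poly R} :=
  f ^+ omega + gamma *: (f ^+ t * G).

Definition ideal_of (L : ideal_label R) : {set {poly %/ k}} :=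
  match L with
  | TypeI_zero => [set 0]
  | TypeI_full => setT
  | TypeII tau => ideal1 (in_qpoly k (gen2 tau))
  | TypeIII omega t G => ideal1 (in_qpoly k (gen3 omega t G))
  | TypeIV omega t G mu =>
      ideal2 (in_qpoly k (gen3 omega t G)) (in_qpoly k (gen2 mu))
  end.

Definition is_kappa (omega t : nat) (G : {poly R}) (kappa : nat) : Prop :=
  let C := ideal1 (in_qpoly k (gen3 omega t G)) in
  [/\ (kappa <= omega)%N, in_qpoly k (gen2 kappa) \in C &
      forall i : nat, in_qpoly k (gen2 i) \in C -> (kappa <= i)%N].

Definition poly_P (d : nat) (a : {poly R}) : Prop :=
  a \is a polyOver T /\ (size a <= d)%N.

(* The conditions on t and G, with b = kappa for Type III and b = mu for
   Type IV. The exponent t is irrelevant when G = 0; it is then set to 0, so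
   that an ideal has only one label. *)
Definition admissible (b t : nat) (G : {poly R}) : Prop :=
  (G = 0 /\ t = 0%N) \/
  [/\ G != 0, (t < b)%N, invertible (in_qpoly k G) &
      exists a : nat -> {poly R},
        (forall i : nat, (i < b - t)%N -> poly_P (size f).-1 (a i)) /\
        G = \sum_(i < b - t) a i * f ^+ i].

Definition listed (L : ideal_label R) : Prop :=
  match L with
  | TypeI_zero => True
  | TypeI_full => True
  | TypeII tau => (tau < q)%N
  | TypeIII omega t G =>
      (0 < omega < q)%N /\
      exists kappa : nat, is_kappa omega t G kappa /\ admissible kappa t G
  | TypeIV omega t G mu =>
      exists kappa : nat,
        [/\ is_kappa omega t G kappa,
            (mu < kappa)%N && (kappa <= omega)%N && (omega < q)%N &
            admissible mu t G]
  end.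

End Listing.

(* Main.v *)
Require Import Defs.
From mathcomp Require Import all_boot all_order all_algebra.
From mathcomp Require finfield.

Set Implicit Arguments.
Unset Strict Implicit.
Unset Printing Implicit Defensive.

Import GRing.Theory.
Local Open Scope ring_scope.

(** An ideal [I] of [K = R[x] / <k>] is governed by two exponents.  Since
    [k = f ^+ q] modulo [gamma], reduction sends [K] onto [F[x] / <fb ^+ q>],
    where [fb] is the reduction of the irreducible polynomial [f]; and since
    [gamma ^+ 2 = 0], multiplication by [gamma] identifies that same quotient
    with the ideal [gamma K].  The ideals of [F[x] / <fb ^+ q>] are the powers
    of [fb], so the image of [I] under reduction is generated by some
    [fb ^+ w] (the residue exponent [w <= q]), while [I] meets [gamma K] in
    [gamma <f ^+ mu>] (the torsion exponent [mu <= w]).  As soon as [P] in [I]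
    reduces to [fb ^+ w], the ideal [I] is generated by [P] and
    [gamma f ^+ mu] ([ideal_of_exps]).

    If [w = q], then [P = k] will do, and [I] is zero or of Type II; if
    [w = 0], then [P] is a unit.  Otherwise [P = f ^+ w + gamma D], and [D] only
    matters modulo [fb ^+ mu]: its [fb]-adic expansion with digits in [T],
    after the factor [f ^+ t] has been taken out, is the unit [G] of the
    statement ([admissible_exists]), and it is unique ([admissible_uniq]).
    The number [kappa] is the torsion exponent of the principal ideal
    [<f ^+ w + gamma f ^+ t G>] contained in [I]; hence [mu <= kappa], with
    equality exactly in Type III ([ideal_listed]).

    Conversely, [w], [mu], [t], [G] can be recovered from a listed ideal, and
    Type III is separated from Type IV by comparing [mu] with [kappa]
    ([ideal_of_inj]).  Finally, were a Type IV ideal generated by one element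
    [a], then [f ^+ w + gamma f ^+ t G = h a] with [h] prime to [fb] after
    reduction, hence [h] a unit, and [gamma f ^+ mu] would lie in the ideal of
    the first generator, against [mu < kappa].

    That the set [T] of the statement represents each residue class once
    follows by counting from the classical fact that 1 is the only power of
    [zeta] reducing to 1 ([teich_inj], [teich_surj]). *)

(** * Powers of an irreducible polynomial *)

Section IrreduciblePowers.
Variables (F : fieldType) (h : {poly F}).
Hypothesis h_irr : irreducible_poly h.

Let h_neq0 : h != 0 := irredp_neq0 h_irr.

Lemma dvdp_exp_irr a b : (h ^+ a %| h ^+ b) = (a <= b)%N.
Proof. by case: h_irr => h_gt1 _; rewrite dvdp_Pexp2l. Qed.

(** Division by [h] is repeated while it is exact; the hypothesis stops it
    before [b] steps, and in particular excludes [A = 0]. *)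
Lemma not_dvdp_exp_factor b (A : {poly F}) : ~~ (h ^+ b %| A) ->
  exists t, exists2 B : {poly F}, (t < b)%N /\ A = h ^+ t * B & ~~ (h %| B).
Proof.
elim: b A => [|b IHb] A; first by rewrite expr0 dvd1p.
have [/dvdpP[C ->]|hA _] := boolP (h %| A); last first.
  by exists 0%N, A; rewrite ?expr0 ?mul1r.
rewrite exprSr dvdp_mul2r ?h_neq0 // => /IHb[t [B [lt_tb ->] hB]].
by exists t.+1, B; rewrite // exprSr mulrAC.
Qed.

Lemma not_dvdp_mul_exp t b (B : {poly F}) :
  (t < b)%N -> ~~ (h %| B) -> ~~ (h ^+ b %| h ^+ t * B).
Proof.
move=> lt_tb; apply: contra => /(dvdp_trans (dvdp_exp2l h lt_tb)).
by rewrite exprSr dvdp_mul2l // expf_neq0.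
Qed.

(** The least [e] with [S (h ^+ e)] works: if [A = h ^+ t * B] is in [S] with
    [t < e] and [B] prime to [h], a Bezout relation between [B] and [h ^+ e]
    puts [h ^+ t] in [S].  The boolean [b] makes the least exponent exist
    constructively. *)
Lemma ideal_exponent (S : {poly F} -> Prop) (b : pred nat) q :
    (forall u A B, S A -> S B -> S (u * A + B)) ->
    (forall e, reflect (S (h ^+ e)) (b e)) -> S (h ^+ q) ->
  exists e, forall A, S A <-> h ^+ e %| A.
Proof.
move=> S_lin bP S_q.
have S_mul u A : S A -> S (u * A).
  move=> SA; have -> : u * A = (u - 1) * A + A by rewrite mulrBl mul1r subrK.
  exact: S_lin.
have ex_b : exists e, b e by exists q; apply/bP.
case: (ex_minnP ex_b) => e /bP S_e min_e; exists e => A.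
split=> [SA|/dvdpP[C ->]]; last exact: S_mul.
apply: contraT => /not_dvdp_exp_factor[t [B [lt_te def_A] hB]].
have: coprimep B (h ^+ e).
  by rewrite coprimep_sym coprimep_expl // irreducible_poly_coprime.
case/Bezout_eq1_coprimepP => -[u v] /= Buv.
suff /bP/min_e : S (h ^+ t) by rewrite leqNgt lt_te.
have -> : h ^+ t = u * A + (v * h ^+ t) * h ^+ e.
  rewrite -[LHS]mulr1 -Buv mulrDr def_A.
  by congr (_ + _); rewrite !mulrA; congr (_ * _); rewrite mulrC.
by apply/S_lin/S_mul.
Qed.

End IrreduciblePowers.

(** * Ideals of a finite commutative ring *)

Section FiniteRingIdeals.
Variable A : finComNzRingType.
Implicit Types (I : {set A}) (a b x : A).

Lemma ideal1P a x : reflect (exists u, x = u * a) (x \in ideal1 a).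
Proof.
by apply: (iffP imsetP) => [[u _ ->]|[u ->]]; exists u.
Qed.

Lemma ideal2P a b x : reflect (exists u v, x = u * a + v * b) (x \in ideal2 a b).
Proof.
apply: (iffP imset2P) => [[u v _ _ ->]|[u [v ->]]]; first by exists u, v.
by exists u v.
Qed.

Lemma ideal1_ideal a : is_ideal (ideal1 a).
Proof.
split=> [|x _ _ /ideal1P[u ->] /ideal1P[v ->]]; apply/ideal1P.
  by exists 0; rewrite mul0r.
by exists (x * u + v); rewrite mulrDl mulrA.
Qed.

Lemma ideal2_ideal a b : is_ideal (ideal2 a b).
Proof.
split=> [|x _ _ /ideal2P[u [u' ->]] /ideal2P[v [v' ->]]]; apply/ideal2P.
  by exists 0, 0; rewrite !mul0r addr0.
exists (x * u + v), (x * u' + v').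
by rewrite !mulrDl mulrDr !mulrA addrACA.
Qed.

Lemma ideal0_ideal : is_ideal [set 0 : A].
Proof.
by split=> [|a u v /set1P-> /set1P->]; rewrite inE // mulr0 addr0.
Qed.

Lemma idealT_ideal : is_ideal [set: A].
Proof. by split=> *; rewrite inE. Qed.

Lemma mem_ideal1 a : a \in ideal1 a.
Proof. by apply/ideal1P; exists 1; rewrite mul1r. Qed.

Section Membership.
Variables (I : {set A}) (I_ideal : is_ideal I).

Lemma ideal_mul u a : a \in I -> u * a \in I.
Proof.
by case: I_ideal => I0 I_lin aI; rewrite -[_ * _]addr0; apply: I_lin.
Qed.

Lemma ideal_add a b : a \in I -> b \in I -> a + b \in I.
Proof. by case: I_ideal => _ I_lin aI bI; rewrite -[a]mul1r; apply: I_lin. Qed.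

Lemma ideal_sub a b : a \in I -> b \in I -> a - b \in I.
Proof.
by move=> aI bI; rewrite addrC -mulN1r; case: I_ideal => _; apply.
Qed.

Lemma ideal1_sub a : a \in I -> ideal1 a \subset I.
Proof. by move=> aI; apply/subsetP => _ /ideal1P[u ->]; apply: ideal_mul. Qed.

Lemma ideal2_sub a b : a \in I -> b \in I -> ideal2 a b \subset I.
Proof.
move=> aI bI; apply/subsetP => _ /ideal2P[u [v ->]].
by apply: ideal_add; apply: ideal_mul.
Qed.

End Membership.
End FiniteRingIdeals.

(** * Polynomials over a chain ring of nilpotency index two *)

Section ChainRing.
Variables (R : finComNzRingType) (gamma : R) (F : finFieldType).
Variable pi : {rmorphism R -> F}.
Hypotheses (gamma_neq0 : gamma != 0) (gamma_sqr0 : gamma ^+ 2 = 0).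
Hypothesis pi_surj : forall y : F, exists x : R, pi x = y.
Hypothesis pi_ker : forall x : R, pi x = 0 <-> x \in ideal1 gamma.

Local Notation red := (map_poly pi).

Lemma pi_gamma : pi gamma = 0.
Proof. exact/pi_ker/mem_ideal1. Qed.

(** If [pi c] is nonzero then [c] has an inverse modulo [gamma], so that
    [gamma] itself is a multiple of [gamma * c]. *)
Lemma mul_gamma_eq0 c : gamma * c = 0 <-> pi c = 0.
Proof.
split=> [gc0|/pi_ker/ideal1P[u ->]]; last first.
  by rewrite mulrCA -expr2 gamma_sqr0 mulr0.
apply/eqP; apply: contraT => pc_neq0.
have [d pd] := pi_surj (pi c)^-1.
have /pi_ker/ideal1P[u def_u] : pi (c * d - 1) = 0.
  by rewrite rmorphB rmorphM rmorph1 pd divff ?subrr.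
case/eqP: gamma_neq0; rewrite -[gamma]mulr1.
have <- : c * d - u * gamma = 1 by rewrite -def_u opprB addrC subrK.
by rewrite mulrBr mulrA gc0 mul0r mulrCA -expr2 gamma_sqr0 mulr0 subr0.
Qed.

Lemma red_scale_gamma P : red (gamma *: P) = 0.
Proof. by rewrite map_polyZ pi_gamma scale0r. Qed.

(** Membership in [<gamma>] is an existence statement on each coefficient; a
    quotient has to be chosen for all coefficients at once. *)
Lemma red_eq0 P : red P = 0 -> exists Q, P = gamma *: Q.
Proof.
move=> redP0; pose c i := odflt 0 [pick u | P`_i == u * gamma].
exists (\poly_(i < size P) c i); apply/polyP => i.
rewrite coefZ coef_poly; case: ltnP => [_|le_Pi]; last first.
  by rewrite mulr0 nth_default.
have /pi_ker/ideal1P[u def_u] : pi P`_i = 0 by rewrite -coef_map redP0 coef0.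
rewrite /c; case: pickP => [v /eqP-> /=|/(_ u)]; first by rewrite mulrC.
by rewrite def_u eqxx.
Qed.

Lemma scale_gamma_eq0 P : gamma *: P = 0 <-> red P = 0.
Proof.
split=> /polyP P0; apply/polyP => i; move: (P0 i).
  by rewrite coefZ coef_map !coef0 => /mul_gamma_eq0.
by rewrite coefZ coef_map !coef0 => /mul_gamma_eq0.
Qed.

Lemma red_eq P Q : red P = red Q -> exists D, P = Q + gamma *: D.
Proof.
move=> eqPQ; have /red_eq0[D def_D] : red (P - Q) = 0.
  by rewrite rmorphB /= eqPQ subrr.
by exists D; rewrite -def_D addrC subrK.
Qed.

Lemma eq_scale_gamma P Q : red P = red Q -> gamma *: P = gamma *: Q.
Proof.
case/red_eq=> D ->; rewrite scalerDr scalerA -expr2 gamma_sqr0 scale0r addr0.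
by [].
Qed.

Lemma red_surj A : exists P, red P = A.
Proof.
elim/poly_ind: A => [|A c [P <-]]; first by exists 0; rewrite rmorph0.
have [x <-] := pi_surj c; exists (P * 'X + x%:P).
by rewrite rmorphD rmorphM /= map_polyX map_polyC.
Qed.

(** * The quotient by a polynomial that reduces to a prime power *)

Section Quotient.
Variables (q : nat) (f g k : {poly R}).
Hypotheses (q_gt0 : (0 < q)%N) (f_irr : irreducible_poly (red f)).
Hypotheses (k_monic : k \is monic) (kE : k = f ^+ q + gamma *: g).

Local Notation K := {poly %/ k}.
Local Notation pr := (in_qpoly k).
Local Notation fb := (red f).

Lemma red_modulus : red k = fb ^+ q.
Proof. by rewrite kE rmorphD /= red_scale_gamma addr0 rmorphXn. Qed.

(** [{poly %/ k}] is the intended quotient because [k] is not constant: its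
    reduction is a positive power of an irreducible polynomial. *)
Lemma mk_monic_modulus : mk_monic k = k.
Proof.
rewrite /mk_monic k_monic andbT; case: leqP => // szk.
have [fb_gt1 _] := f_irr.
have: (size (red k) <= 1)%N by apply: leq_trans szk; rewrite size_poly.
rewrite red_modulus leqNgt (leq_trans fb_gt1) //.
rewrite -[X in (X <= _)%N]/(size (fb ^+ 1)).
by rewrite dvdp_leq ?expf_neq0 ?irredp_neq0 // dvdp_exp2l.
Qed.

Lemma pr_val (a : K) : pr (val a) = a.
Proof. exact/val_inj/in_qpoly_small/size_mk_monic. Qed.

Lemma pr_eq0 P : pr P = 0 <-> exists Q, P = Q * k.
Proof.
have prP : reflect (exists Q, P = Q * k) (pr P == 0).
  rewrite -val_eqE /= mk_monic_modulus.
  exact: (Pdiv.RingMonic.rdvdpP k_monic).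
by split=> [/eqP/prP|/prP/eqP].
Qed.

Lemma red_dvd_of_pr_eq0 P : pr P = 0 -> fb ^+ q %| red P.
Proof.
by move=> /pr_eq0[Q ->]; rewrite rmorphM /= red_modulus dvdp_mull.
Qed.

(** Multiplication by [gamma] identifies [F[x] / <fb ^+ q>] with [gamma K]:
    if [gamma P = Q k], then reducing gives [Q = gamma D], and [gamma] can be
    cancelled up to a polynomial reducing to 0. *)
Lemma pr_scale_gamma_eq0 P : pr (gamma *: P) = 0 <-> fb ^+ q %| red P.
Proof.
split=> [/pr_eq0[Q gPQ]|/dvdpP[A def_P]].
  have /red_eq0[D def_Q] : red Q = 0.
    apply/eqP; have/eqP := congr1 red gPQ.
    rewrite red_scale_gamma rmorphM /= red_modulus eq_sym mulf_eq0.
    by rewrite expf_eq0 (negPf (irredp_neq0 f_irr)) andbF orbF.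
  have : gamma *: (P - D * k) = 0.
    by rewrite scalerBr gPQ def_Q scalerAl subrr.
  move/scale_gamma_eq0/eqP; rewrite rmorphB subr_eq0 => /eqP->.
  by rewrite rmorphM /= red_modulus dvdp_mull.
have [B def_A] := red_surj A; apply/pr_eq0; exists (gamma *: B).
rewrite -scalerAl; apply: eq_scale_gamma.
by rewrite rmorphM /= red_modulus def_A.
Qed.

Lemma pr_eq_red P Q : pr P = pr Q -> fb ^+ q %| red P - red Q.
Proof.
move=> eqPQ; rewrite -rmorphB; apply: red_dvd_of_pr_eq0.
by rewrite rmorphB /= eqPQ subrr.
Qed.

(** A Bezout relation for [red P] and [fb ^+ q] lifts to [P U = 1 + gamma D] in
    [K], and [1 + gamma D] has inverse [1 - gamma D]. *)
Lemma invertible_pr P : invertible (pr P) <-> ~~ (fb %| red P).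
Proof.
split=> [[a PaE]|fP].
  have: pr (P * val a) = pr 1 by rewrite rmorphM /= pr_val PaE rmorph1.
  move/pr_eq_red/(dvdp_trans (dvdp_exp2l fb q_gt0)); rewrite expr1.
  rewrite rmorph1 rmorphM; apply: contraL => fP.
  rewrite dvdp_addr ?dvdp_mulr // dvdpNr dvdp1.
  by case: f_irr => fb_gt1 _; rewrite neq_ltn fb_gt1 orbT.
have: coprimep (red P) (fb ^+ q).
  by rewrite coprimep_sym coprimep_expl // irreducible_poly_coprime.
case/Bezout_eq1_coprimepP=> -[u v] /=.
have [U <-] := red_surj u; have [V <-] := red_surj v.
rewrite -red_modulus -!rmorphM -rmorphD /=.
rewrite -[X in _ = X](rmorph1 (map_poly pi)) => /red_eq[D UPVk].
have prUP : pr P * pr U = 1 + pr (gamma *: D).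
  rewrite -(rmorph1 (in_qpoly k)) -rmorphD -rmorphM /= -UPVk rmorphD /=.
  rewrite [in RHS]mulrC -[LHS]addr0; congr (_ + _).
  by apply/esym/pr_eq0; exists V.
exists (pr U * (1 - pr (gamma *: D))).
rewrite mulrA prUP mulrBr mulr1 mulrDl mul1r -rmorphM /=.
rewrite -scalerAl -scalerAr scalerA -expr2 gamma_sqr0 scale0r rmorph0 addr0.
by rewrite addrK.
Qed.

(** * Residue and torsion exponents of an ideal *)

Definition residue_exp (I : {set K}) (w : nat) : Prop :=
  (forall P, pr P \in I -> fb ^+ w %| red P) /\
  (exists2 P, pr P \in I & red P = fb ^+ w).

(** The set of [P] with [gamma P] in [I] is an ideal of [R[x]] that depends only
    on reductions; this is the torsion ideal of the theory of codes over chain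
    rings. *)
Definition torsion_exp (I : {set K}) (mu : nat) : Prop :=
  forall P, pr (gamma *: P) \in I <-> fb ^+ mu %| red P.

(** Representatives of the same element of [K] have reductions that agree modulo
    [fb ^+ q], so membership of a power of [fb] in the reduction of [I] is
    decided by searching the finite set [I]. *)
Lemma residue_exp_exists I : is_ideal I -> exists w, residue_exp I w.
Proof.
move=> I_ideal; pose S A := exists2 P, pr P \in I & red P = A.
pose b e := [exists a in I, fb ^+ q %| red (val (a : K)) - fb ^+ e].
have S_lin u A B : S A -> S B -> S (u * A + B).
  case=> P PI <- [Q QI <-]; have [U <-] := red_surj u.
  exists (U * P + Q); last by rewrite rmorphD rmorphM.
  by rewrite rmorphD rmorphM /= (I_ideal.2 (pr U)).
have S_mul_q u : S (u * fb ^+ q).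
  have [U <-] := red_surj u; rewrite -red_modulus -rmorphM.
  exists (U * k) => //; have -> : pr (U * k) = 0 by apply/pr_eq0; exists U.
  by case: I_ideal.
have bP e : reflect (S (fb ^+ e)) (b e).
  apply: (iffP exists_inP) => [[a aI /dvdpP[u def_u]]|[P PI redP]].
    have -> : fb ^+ e = - u * fb ^+ q + red (val a).
      by rewrite mulNr -def_u opprB subrK.
    rewrite -[- u * _]mul1r; apply: S_lin => //.
    by exists (val a); rewrite ?pr_val.
  by exists (pr P) => //; rewrite -redP pr_eq_red ?pr_val.
have S_q : S (fb ^+ q) by rewrite -[_ ^+ _]mul1r.
have [e eP] := ideal_exponent f_irr S_lin bP S_q; exists e.
split=> [P PI|]; first by apply/eP; exists P.
by case/eP: (dvdpp (fb ^+ e)) => P; exists P.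
Qed.

Lemma torsion_exp_exists I : is_ideal I -> exists mu, torsion_exp I mu.
Proof.
move=> I_ideal; pose S A := exists2 P, pr (gamma *: P) \in I & red P = A.
have gammaI P Q : pr (gamma *: P) \in I -> red P = red Q -> pr (gamma *: Q) \in I.
  by move=> PI /eq_scale_gamma <-.
have S_lin u A B : S A -> S B -> S (u * A + B).
  case=> P PI <- [Q QI <-]; have [U <-] := red_surj u.
  exists (U * P + Q); last by rewrite rmorphD rmorphM.
  by rewrite scalerDr scalerAr rmorphD rmorphM /= (I_ideal.2 (pr U)).
have bP e : reflect (S (fb ^+ e)) (pr (gamma *: f ^+ e) \in I).
  apply: (iffP idP) => [eI|[P PI redP]].
    by exists (f ^+ e); rewrite ?rmorphXn.
  by apply: gammaI PI _; rewrite redP rmorphXn.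
have S_q : S (fb ^+ q).
  exists (f ^+ q); last by rewrite rmorphXn.
  have -> : pr (gamma *: f ^+ q) = 0 by apply/pr_scale_gamma_eq0; rewrite rmorphXn.
  by case: I_ideal.
have [e eP] := ideal_exponent f_irr S_lin bP S_q; exists e => P.
split=> [PI|]; first by apply/eP; exists P.
by case/eP=> Q QI; apply: gammaI.
Qed.

Lemma residue_exp_inj I w1 w2 : residue_exp I w1 -> residue_exp I w2 -> w1 = w2.
Proof.
case=> dvd1 [P1 P1I red1] [dvd2 [P2 P2I red2]]; apply/eqP.
rewrite eqn_leq -!(dvdp_exp_irr f_irr).
by apply/andP; split; [rewrite -red2; apply: dvd1 | rewrite -red1; apply: dvd2].
Qed.

Lemma torsion_exp_inj I m1 m2 : torsion_exp I m1 -> torsion_exp I m2 -> m1 = m2.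
Proof.
suff le_exp a b : torsion_exp I a -> torsion_exp I b -> (a <= b)%N.
  by move=> tor1 tor2; apply/eqP; rewrite eqn_leq !le_exp.
move=> tor_a tor_b; rewrite -(dvdp_exp_irr f_irr) -(rmorphXn _ b).
by apply/tor_a/tor_b; rewrite rmorphXn.
Qed.

Lemma residue_exp_le I w : is_ideal I -> residue_exp I w -> (w <= q)%N.
Proof.
case=> I0 _ [wI _]; rewrite -(dvdp_exp_irr f_irr) -red_modulus wI //.
by have -> : pr k = 0 by apply/pr_eq0; exists 1; rewrite mul1r.
Qed.

Lemma torsion_exp_le I mu P w :
  is_ideal I -> torsion_exp I mu -> pr P \in I -> red P = fb ^+ w -> (mu <= w)%N.
Proof.
move=> I_ideal tor PI redP; rewrite -(dvdp_exp_irr f_irr) -redP; apply/tor.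
by rewrite -mul_polyC rmorphM ideal_mul.
Qed.

(** Subtracting from an element of [I] a multiple of [P] with the same reduction
    leaves an element of [I] in [gamma K], a multiple of [gamma f ^+ mu]. *)
Lemma ideal_of_exps I w mu P :
    is_ideal I -> residue_exp I w -> torsion_exp I mu ->
    pr P \in I -> red P = fb ^+ w ->
  I = ideal2 (pr P) (pr (gen2 gamma f mu)).
Proof.
move=> I_ideal [wI _] tor PI redP; apply/eqP; rewrite eqEsubset andbC.
rewrite ideal2_sub //=; last by apply/tor; rewrite rmorphXn.
apply/subsetP => x; rewrite -(pr_val x) => xI; apply/ideal2P.
have /dvdpP[u] := wI _ xI; have [U <-] := red_surj u.
rewrite -redP -rmorphM => /red_eq[D xE].
have : pr (gamma *: D) \in I.
  have -> : pr (gamma *: D) = pr (val x) - pr U * pr P.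
    by rewrite xE rmorphD rmorphM /= addrC addKr.
  by rewrite ideal_sub // ideal_mul.
move/tor/dvdpP=> [v]; have [V <-] := red_surj v.
rewrite -rmorphXn -rmorphM => /eq_scale_gamma def_D.
exists (pr U), (pr V).
by rewrite xE def_D /gen2 scalerAr rmorphD !rmorphM.
Qed.

Lemma residue_exp_ideal2 w mu P : (w <= q)%N -> red P = fb ^+ w ->
  residue_exp (ideal2 (pr P) (pr (gen2 gamma f mu))) w.
Proof.
move=> le_wq redP; split=> [Q /ideal2P[u [v]]|]; last first.
  by exists P => //; apply/ideal2P; exists 1, 0; rewrite mul1r mul0r addr0.
rewrite -(pr_val u) -(pr_val v) -!rmorphM -rmorphD /gen2 -scalerAr.
move/pr_eq_red/(dvdp_trans (dvdp_exp2l fb le_wq)).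
rewrite rmorphD rmorphM /= red_scale_gamma addr0 redP.
by move=> fQ; rewrite -[red Q](subrK (red (val u) * fb ^+ w)) dvdp_add ?dvdp_mull.
Qed.

(** If [gamma Q = u P + v gamma f ^+ mu], then [u P] is in [gamma K] and in
    [<P>], hence is divisible by [gamma f ^+ kap]. *)
Lemma torsion_exp_ideal2 mu kap P : (mu <= kap)%N ->
    torsion_exp (ideal1 (pr P)) kap ->
  torsion_exp (ideal2 (pr P) (pr (gen2 gamma f mu))) mu.
Proof.
move=> le_mu tor Q; split=> [/ideal2P[u [v]]|/dvdpP[v]]; last first.
  have [V <-] := red_surj v; rewrite -rmorphXn -rmorphM => /eq_scale_gamma->.
  by apply/ideal2P; exists 0, (pr V); rewrite mul0r add0r -rmorphM scalerAr.
rewrite -(pr_val v) -rmorphM /gen2 -scalerAr => /eqP; rewrite -subr_eq.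
rewrite -rmorphB -scalerBr => /eqP QE.
have /tor/(dvdp_trans (dvdp_exp2l fb le_mu)) :
  pr (gamma *: (Q - val v * f ^+ mu)) \in ideal1 (pr P).
  by apply/ideal1P; exists u.
rewrite rmorphB rmorphM rmorphXn /= => fQ.
by rewrite -[red Q](subrK (red (val v) * fb ^+ mu)) dvdp_add ?dvdp_mull.
Qed.

Lemma ideal1_torsion kap P : torsion_exp (ideal1 (pr P)) kap ->
  ideal1 (pr P) = ideal2 (pr P) (pr (gen2 gamma f kap)).
Proof.
move=> tor; apply/eqP; rewrite eqEsubset ideal1_sub ?ideal2_sub ?mem_ideal1 //=.
- exact: ideal1_ideal.
- by apply/tor; rewrite rmorphXn.
- exact: ideal2_ideal.
by apply/ideal2P; exists 1, 0; rewrite mul1r mul0r addr0.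
Qed.

Lemma red_gen3 w t G : red (gen3 gamma f w t G) = fb ^+ w.
Proof. by rewrite rmorphD /= red_scale_gamma addr0 rmorphXn. Qed.

(** The least [i] with [gamma f ^+ i] in an ideal is its torsion exponent, and
    here it is at most [w] because [gamma] times the generator is
    [gamma f ^+ w]. *)
Lemma is_kappaP w t G kap : is_kappa gamma f k w t G kap <->
  torsion_exp (ideal1 (pr (gen3 gamma f w t G))) kap.
Proof.
have C_ideal := ideal1_ideal (pr (gen3 gamma f w t G)).
have tor_le e i : torsion_exp (ideal1 (pr (gen3 gamma f w t G))) e ->
    pr (gen2 gamma f i) \in ideal1 (pr (gen3 gamma f w t G)) <-> (e <= i)%N.
  by move=> tor; rewrite -(dvdp_exp_irr f_irr) -(rmorphXn _ i); apply: tor.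
split=> [[_ kapC kap_min]|tor].
  have [e tor] := torsion_exp_exists C_ideal.
  have -> // : kap = e.
  apply/eqP; rewrite eqn_leq kap_min ?(iffLR (tor_le _ _ tor)) //.
  exact/(tor_le _ _ tor).
split; last by move=> i /(tor_le _ _ tor).
  exact: torsion_exp_le C_ideal tor (mem_ideal1 _) (red_gen3 w t G).
exact/(tor_le _ _ tor).
Qed.

Lemma torsion_exp_zero : torsion_exp [set 0] q.
Proof.
by move=> P; split=> [/set1P/pr_scale_gamma_eq0|/pr_scale_gamma_eq0/set1P].
Qed.

Lemma pr_modulus : pr k = 0.
Proof. by apply/pr_eq0; exists 1; rewrite mul1r. Qed.

(** * Expansions with digits in a set of representatives *)

Section Digits.
Variable T : {set R}.
Hypotheses (f_monic : f \is monic) (T0 : 0 \in T).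
Hypotheses (T_inj : {in T &, injective pi}).
Hypothesis T_surj : forall y : F, exists2 x, x \in T & pi x = y.

Let d := (size f).-1.

Lemma size_red_f : size fb = size f.
Proof. by apply: size_map_poly_id0; rewrite (eqP f_monic) rmorph1 oner_neq0. Qed.

Let f_gt0 : (0 < size f)%N.
Proof. by rewrite -size_red_f; case: f_irr => /ltnW. Qed.

Lemma digit_coef a i : a \is a polyOver T -> a`_i \in T.
Proof.
move=> aT; have [lt_ia|le_ai] := ltnP i (size a); last by rewrite nth_default.
exact: (all_nthP 0 aT).
Qed.

Lemma digit_inj a b : poly_P T d a -> poly_P T d b -> red a = red b -> a = b.
Proof.
move=> [aT _] [bT _] eq_ab; apply/polyP => i.
by apply: T_inj; rewrite ?digit_coef // -!coef_map eq_ab.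
Qed.

Lemma digit_lift (A : {poly F}) :
  (size A < size fb)%N -> exists2 a, poly_P T d a & red a = A.
Proof.
move=> szA; pose c i := odflt 0 [pick x in T | pi x == A`_i].
have [cT pi_c] : (forall i, c i \in T) /\ (forall i, pi (c i) = A`_i).
  suff cP i : c i \in T /\ pi (c i) = A`_i by split=> i; case: (cP i).
  rewrite /c; case: pickP => [x /andP[xT /eqP] //|].
  by have [x xT <-] := T_surj A`_i => /(_ x)/andP[]; rewrite xT eqxx.
exists (\poly_(i < size A) c i); last first.
  apply/polyP => i; rewrite coef_map coef_poly.
  by case: ltnP => [_|le_Ai]; [exact: pi_c | rewrite nth_default ?raddf0].
split; first by apply: polyOver_poly.
by rewrite (leq_trans (size_poly _ _)) // -ltnS prednK // -size_red_f.
Qed.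

(** Repeated division of [A] by [fb], each remainder being lifted to a digit. *)
Lemma digits_exist b A : exists a : nat -> {poly R},
  (forall i, poly_P T d (a i)) /\ fb ^+ b %| A - red (\sum_(i < b) a i * f ^+ i).
Proof.
elim: b A => [|b IHb] A.
  exists (fun=> 0); split=> [i|]; last by rewrite expr0 dvd1p.
  by split; rewrite ?size_poly0 //; apply/(all_nthP 0) => j; rewrite size_poly0.
have [a [aP aE]] := IHb (A %/ fb).
have [|a0 a0P red_a0] := @digit_lift (A %% fb).
  by rewrite ltn_modp irredp_neq0.
exists (fun i => if i is i'.+1 then a i' else a0); split=> [[]//|].
rewrite big_ord_recl expr0 mulr1.
have -> : \sum_(i < b) a i * f ^+ (lift ord0 i) = (\sum_(i < b) a i * f ^+ i) * f.
  by rewrite mulr_suml; apply: eq_bigr => i _; rewrite exprSr mulrA.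
rewrite {1}(divp_eq A fb) rmorphD rmorphM /= red_a0 opprD addrA addrK.
by rewrite -mulrBl exprSr dvdp_mul.
Qed.

(** Modulo [fb] only the digits of index 0 survive, and they are determined by
    their reductions for lack of room in degree; the rest is divisible by
    [f]. *)
Lemma digits_uniq b (a a' : nat -> {poly R}) :
    (forall i, (i < b)%N -> poly_P T d (a i)) ->
    (forall i, (i < b)%N -> poly_P T d (a' i)) ->
    fb ^+ b %| red (\sum_(i < b) a i * f ^+ i) - red (\sum_(i < b) a' i * f ^+ i) ->
  \sum_(i < b) a i * f ^+ i = \sum_(i < b) a' i * f ^+ i.
Proof.
elim: b a a' => [|b IHb] a a' aP a'P; first by rewrite !big_ord0.
have sumE (c : nat -> {poly R}) : \sum_(i < b.+1) c i * f ^+ i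
    = c 0%N + (\sum_(i < b) c i.+1 * f ^+ i) * f.
  rewrite big_ord_recl expr0 mulr1 mulr_suml; congr (_ + _).
  by apply: eq_bigr => i _; rewrite exprSr mulrA.
rewrite !sumE !rmorphD !rmorphM /= opprD addrACA -mulrBl => dvd_ab.
have a0E : a 0%N = a' 0%N.
  apply: digit_inj; [exact: aP | exact: a'P | apply/eqP].
  have : fb %| red (a 0%N) - red (a' 0%N).
    have : fb %| fb ^+ b.+1 by rewrite exprS dvdp_mulr.
    by move/dvdp_trans/(_ dvd_ab); rewrite dvdp_addl // dvdp_mull.
  rewrite -subr_eq0; apply: contraLR => /dvdp_leq leq_fb.
  apply/negP => /leq_fb; rewrite leqNgt (leq_ltn_trans (size_polyD _ _)) //.
  rewrite size_polyN size_red_f gtn_max -(prednK f_gt0) !ltnS.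
  by rewrite !(leq_trans (size_poly _ _)) //; [case: (a'P 0%N) | case: (aP 0%N)].
move: dvd_ab; rewrite a0E subrr add0r exprSr dvdp_mul2r ?(irredp_neq0 f_irr) //.
move/(IHb (fun i => a i.+1) (fun i => a' i.+1))-> => // i lt_ib.
  exact: aP.
exact: a'P.
Qed.

(** Writing [A = fb ^+ t * B] with [fb] prime to [B], the unit [G] is the
    expansion of [B] truncated at [b - t]; the label [G = 0] is left for the
    multiples of [fb ^+ b]. *)
Lemma admissible_exists b A :
  exists t G, admissible T f k b t G /\ fb ^+ b %| A - red (f ^+ t * G).
Proof.
have [fbA|] := boolP (fb ^+ b %| A).
  by exists 0%N, 0; split; [left | rewrite mulr0 rmorph0 subr0].
case/(not_dvdp_exp_factor f_irr)=> t [B [lt_tb ->] fB].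
have [a [aP aE]] := digits_exist (b - t) B.
pose G := \sum_(i < b - t) a i * f ^+ i; rewrite -/G in aE.
have fG : ~~ (fb %| red G).
  apply: contra fB => fG; rewrite -[B](subrK (red G)) dvdp_add //.
  by apply: dvdp_trans aE; rewrite -[X in X %| _]expr1 dvdp_exp2l // subn_gt0.
exists t, G; split; last first.
  rewrite rmorphM rmorphXn /= -mulrBr -(subnKC (ltnW lt_tb)) exprD.
  by rewrite dvdp_mul2l // expf_neq0 // irredp_neq0.
right; split=> //; last by exists a.
  by apply: contraNneq fG => ->; rewrite rmorph0 dvdp0.
exact/invertible_pr.
Qed.

Lemma admissible_not_dvdp b t G :
  admissible T f k b t G -> G != 0 -> ~~ (fb ^+ b %| red (f ^+ t * G)).
Proof.
case=> [[-> _]|[_ lt_tb /invertible_pr fG _] _]; first by rewrite eqxx.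
by rewrite rmorphM rmorphXn not_dvdp_mul_exp.
Qed.

(** The exponent [t] is the valuation of [fb ^+ t * red G], readable modulo
    [fb ^+ b] because [t < b]; then [G] is read from its digits. *)
Lemma admissible_uniq b t1 G1 t2 G2 :
    admissible T f k b t1 G1 -> admissible T f k b t2 G2 ->
    fb ^+ b %| red (f ^+ t1 * G1) - red (f ^+ t2 * G2) ->
  t1 = t2 /\ G1 = G2.
Proof.
move=> adm1 adm2 dvd12.
have [dvd1 dvd2] := (admissible_not_dvdp adm1, admissible_not_dvdp adm2).
have dvdE : (fb ^+ b %| red (f ^+ t1 * G1)) = (fb ^+ b %| red (f ^+ t2 * G2)).
  by rewrite -{1}(subrK (red (f ^+ t2 * G2)) (red (f ^+ t1 * G1))) dvdp_addr.
case: adm1 adm2 => [[G1_0 ->]|[G1_neq0 lt_t1b iG1 [a1 [a1P def_G1]]]].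
  rewrite G1_0 mulr0 rmorph0 dvdp0 in dvdE => -[[-> ->] //|[G2_neq0 _ _ _]].
  by move: (dvd2 G2_neq0); rewrite -dvdE.
case=> [[G2_0 _]|[G2_neq0 lt_t2b iG2 [a2 [a2P def_G2]]]].
  by move: (dvd1 G1_neq0); rewrite dvdE G2_0 mulr0 rmorph0 dvdp0.
have lt_false t t' G G' : (t < t' < b)%N -> ~~ (fb %| red G) ->
    ~~ (fb ^+ b %| red (f ^+ t * G) - red (f ^+ t' * G')).
  case/andP=> lt_tt' lt_t'b fG.
  apply/negP => /(dvdp_trans (dvdp_exp2l fb (ltnW lt_t'b))).
  rewrite !rmorphM !rmorphXn /= dvdp_subl; last exact: dvdp_mulr.
  by apply/negP; rewrite not_dvdp_mul_exp.
have eq_t : t1 = t2.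
  have [lt_t|lt_t|//] := ltngtP t1 t2.
    have := lt_false t1 t2 G1 G2 _ (iffLR (invertible_pr G1) iG1).
    by rewrite lt_t dvd12 => /(_ lt_t2b).
  have := lt_false t2 t1 G2 G1 _ (iffLR (invertible_pr G2) iG2).
  by rewrite lt_t -dvdpNr opprB dvd12 => /(_ lt_t1b).
split=> //; move: a2P def_G2 dvd12; rewrite -eq_t => a2P def_G2.
rewrite !rmorphM !rmorphXn /= -mulrBr -[X in _ ^+ X %| _](subnKC (ltnW lt_t1b)).
rewrite exprD dvdp_mul2l ?expf_neq0 ?(irredp_neq0 f_irr) //.
rewrite def_G1 def_G2; exact: digits_uniq.
Qed.

(** * Exponents and generators of the listed ideals *)

Local Notation lst := (listed T gamma q f k).
Local Notation idl := (ideal_of gamma f k).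

Definition label_gen (L : ideal_label R) : option (nat * nat * {poly R}) :=
  match L with
  | TypeIII omega t G => Some (omega, t, G)
  | TypeIV omega t G _ => Some (omega, t, G)
  | _ => None
  end.

(** The exponents that a label announces: the residue exponent [w] and the
    torsion exponent [mu], where [q] stands for the exponent of the zero ideal
    of [F[x] / <fb ^+ q>]. *)
Definition label_exps (L : ideal_label R) (w mu : nat) : Prop :=
  match L with
  | TypeI_zero => w = q /\ mu = q
  | TypeI_full => w = 0%N /\ mu = 0%N
  | TypeII tau => w = q /\ mu = tau
  | TypeIII omega t G => w = omega /\ is_kappa gamma f k omega t G mu
  | TypeIV omega t G m => w = omega /\ mu = m
  end.

(** Since [k] is zero in [K] and reduces to [fb ^+ q], this brings the Types I
    and II under the common form of [ideal_of_exps]. *)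
Lemma ideal1_gen2 tau :
  ideal1 (pr (gen2 gamma f tau)) = ideal2 (pr k) (pr (gen2 gamma f tau)).
Proof.
rewrite pr_modulus; apply/setP => x.
apply/ideal1P/ideal2P => [[v ->]|[u [v ->]]].
  by exists 0, v; rewrite mul0r add0r.
by exists v; rewrite mulr0 add0r.
Qed.

Lemma ideal1_modulus : ideal1 (pr k) = [set 0].
Proof.
rewrite pr_modulus; apply/setP => x; rewrite inE.
by apply/ideal1P/eqP => [[u ->]|->]; [rewrite mulr0 | exists 0; rewrite mulr0].
Qed.

Lemma label_ideal L : is_ideal (idl L).
Proof.
case: L => [||tau|w t G|w t G mu] /=.
- exact: ideal0_ideal.
- exact: idealT_ideal.
- exact: ideal1_ideal.
- exact: ideal1_ideal.
exact: ideal2_ideal.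
Qed.

Lemma listed_exps L : lst L ->
  exists w mu,
    [/\ label_exps L w mu, residue_exp (idl L) w & torsion_exp (idl L) mu].
Proof.
have tor_k : torsion_exp (ideal1 (pr k)) q.
  by rewrite ideal1_modulus; apply: torsion_exp_zero.
case: L => [||tau|w t G|w t G mu] /=.
- exists q, q; split=> //; last exact: torsion_exp_zero.
  rewrite -ideal1_modulus (ideal1_torsion tor_k).
  exact/residue_exp_ideal2/red_modulus.
- exists 0%N, 0%N; split=> // [|P]; last by rewrite inE expr0 dvd1p.
  split=> [P _|]; first by rewrite expr0 dvd1p.
  by exists 1; rewrite ?inE // rmorph1.
- move=> lt_tau; exists q, tau; rewrite ideal1_gen2; split=> //.
    exact/residue_exp_ideal2/red_modulus.
  exact: torsion_exp_ideal2 (ltnW lt_tau) tor_k.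
- case=> /andP[_ lt_wq] [kap [kapP _]]; exists w, kap; split=> //.
    rewrite (ideal1_torsion (iffLR (is_kappaP _ _ _ _) kapP)).
    exact: residue_exp_ideal2 (ltnW lt_wq) (red_gen3 _ _ _).
  exact/is_kappaP.
case=> kap [kapP /andP[/andP[lt_mu _] lt_wq] _]; exists w, mu; split=> //.
  exact: residue_exp_ideal2 (ltnW lt_wq) (red_gen3 _ _ _).
exact: torsion_exp_ideal2 (ltnW lt_mu) (iffLR (is_kappaP _ _ _ _) kapP).
Qed.

(** The trivial ideals and Type II are the extreme residue exponents.  In
    between, a lift [f ^+ w + gamma D] of [fb ^+ w] is corrected within [I] so
    that its [gamma]-part is an admissible expansion, and Types III and IV
    differ by whether the torsion of [I] is already reached by the first
    generator. *)
Lemma ideal_listed I : is_ideal I -> exists L, lst L /\ I = idl L.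
Proof.
move=> I_ideal; have [w res_w] := residue_exp_exists I_ideal.
have [mu tor_mu] := torsion_exp_exists I_ideal.
(* the zero element of K, represented by k, is the lift of fb ^+ w when w = q *)
have kI : pr k \in I by rewrite pr_modulus; case: I_ideal.
have [P PI redP] := res_w.2.
have := residue_exp_le I_ideal res_w; rewrite leq_eqVlt => /orP[/eqP w_q|lt_wq].
  rewrite w_q in res_w redP.
  have IE := ideal_of_exps I_ideal res_w tor_mu kI red_modulus.
  have := torsion_exp_le I_ideal tor_mu kI red_modulus.
  rewrite leq_eqVlt => /orP[/eqP mu_q|lt_mu]; last first.
    by exists (TypeII mu); split; rewrite //= ideal1_gen2.
  exists TypeI_zero; split=> //=; rewrite IE -ideal1_gen2 mu_q -ideal1_modulus.
  congr ideal1; rewrite pr_modulus; apply/pr_scale_gamma_eq0.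
  by rewrite rmorphXn.
have [w0|w_gt0] := posnP w.
  exists TypeI_full; split=> //=; apply/setP => x; rewrite inE.
  have [|b Pb] := iffRL (invertible_pr P).
    rewrite redP w0 expr0 dvdp1; case: f_irr => fb_gt1 _.
    by rewrite neq_ltn fb_gt1 orbT.
  have -> : x = (x * b) * pr P by rewrite -mulrA [b * _]mulrC Pb mulr1.
  exact: ideal_mul.
have [|D PE] := @red_eq P (f ^+ w); first by rewrite redP rmorphXn.
have [t [G [adm dvd_DG]]] := admissible_exists mu (red D).
have genI : pr (gen3 gamma f w t G) \in I.
  have -> : pr (gen3 gamma f w t G) = pr P - pr (gamma *: (D - f ^+ t * G)).
    rewrite -rmorphB /=; congr pr.
    by rewrite PE /gen3 scalerBr opprB addrA [X in X - _]addrAC addrK.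
  by rewrite ideal_sub //; apply/tor_mu; rewrite rmorphB.
have IE := ideal_of_exps I_ideal res_w tor_mu genI (red_gen3 _ _ _).
have C_ideal := ideal1_ideal (pr (gen3 gamma f w t G)).
have [kap tor_kap] := torsion_exp_exists C_ideal.
have kapP := iffRL (is_kappaP _ _ _ _) tor_kap.
have le_kap : (mu <= kap)%N.
  rewrite -(dvdp_exp_irr f_irr) -(rmorphXn _ kap); apply/tor_mu.
  by apply: (subsetP (ideal1_sub I_ideal genI)); case: kapP.
have [le_kap_w _ _] := kapP.
move: le_kap; rewrite leq_eqVlt => /orP[/eqP mu_kap|lt_mu].
  exists (TypeIII w t G); rewrite /= w_gt0 lt_wq; split.
    by split=> //; exists kap; rewrite -{2}mu_kap.
  by rewrite IE mu_kap -ideal1_torsion.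
exists (TypeIV w t G mu); split=> //=.
by exists kap; split; rewrite // lt_mu le_kap_w.
Qed.

(** The difference of two candidates for the first generator lies in
    [gamma K], where membership in [I] is divisibility by [fb ^+ mu]. *)
Lemma gen3_uniq I w mu t1 G1 t2 G2 : is_ideal I -> torsion_exp I mu ->
    pr (gen3 gamma f w t1 G1) \in I -> pr (gen3 gamma f w t2 G2) \in I ->
    admissible T f k mu t1 G1 -> admissible T f k mu t2 G2 ->
  t1 = t2 /\ G1 = G2.
Proof.
move=> I_ideal tor I1 I2 adm1 adm2; apply: admissible_uniq adm1 adm2 _.
rewrite -rmorphB; apply/tor.
have -> : pr (gamma *: (f ^+ t1 * G1 - f ^+ t2 * G2)) =
    pr (gen3 gamma f w t1 G1) - pr (gen3 gamma f w t2 G2).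
  rewrite -rmorphB /=; congr pr.
  by rewrite /gen3 scalerBr opprD addrACA subrr add0r.
exact: ideal_sub.
Qed.

Lemma listed_gen3 L w t G : lst L -> label_gen L = Some (w, t, G) ->
  exists mu, [/\ label_exps L w mu, torsion_exp (idl L) mu, (0 < w < q)%N,
    pr (gen3 gamma f w t G) \in idl L & admissible T f k mu t G].
Proof.
case: L => //= [w' t' G'|w' t' G' mu] lstL [<- <- <-].
  case: lstL => w_bound [kap [kapP adm]]; exists kap.
  split=> //; last exact: mem_ideal1.
  exact/is_kappaP.
case: lstL => kap [kapP /andP[/andP[lt_mu le_kap] lt_wq] adm].
exists mu; split=> //.
- exact: torsion_exp_ideal2 (ltnW lt_mu) (iffLR (is_kappaP _ _ _ _) kapP).
- by rewrite lt_wq (leq_trans _ le_kap) // (leq_ltn_trans _ lt_mu).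
by apply/ideal2P; exists 1, 0; rewrite mul1r mul0r addr0.
Qed.

(** With the same first generator, a Type III ideal has torsion exponent
    [kappa] and a Type IV ideal one that is smaller than [kappa]. *)
Lemma label_gen_eq L1 L2 w t G : lst L1 -> lst L2 -> idl L1 = idl L2 ->
    label_gen L1 = Some (w, t, G) -> label_gen L2 = Some (w, t, G) ->
  L1 = L2.
Proof.
move=> lst1 lst2 eqI gen1 gen2.
have [mu [exp1 tor1 _ _ _]] := listed_gen3 lst1 gen1.
have [mu' [exp2 tor2 _ _ _]] := listed_gen3 lst2 gen2.
rewrite -eqI in tor2; have eq_mu := torsion_exp_inj tor2 tor1.
rewrite eq_mu in exp2.
have no_IV m : lst (TypeIV w t G m) -> is_kappa gamma f k w t G m -> False.
  case=> kap [[_ kapC kap_min] /andP[/andP[lt_m _] _] _] [_ mC _].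
  by move: lt_m; rewrite ltnNge kap_min.
case: L1 L2 gen1 gen2 lst1 lst2 exp1 exp2 {eqI tor1 tor2}
  => [||?|w1 t1 G1|w1 t1 G1 m1] //.
  case=> //= [w2 t2 G2|w2 t2 G2 m2] [-> -> ->] [-> -> ->] //.
  by move=> _ lst2 [_ kapP] [_ def_m2]; rewrite -def_m2 in lst2; case: (no_IV mu).
case=> //= [w2 t2 G2|w2 t2 G2 m2] [-> -> ->] [-> -> ->] //.
  by move=> lst1 _ [_ def_m1] [_ kapP]; rewrite -def_m1 in lst1; case: (no_IV mu).
by move=> _ _ [_ <-] [_ <-].
Qed.

(** The exponents tell which labels have a first generator ([0 < w < q]); among
    these, [gen3_uniq] and [label_gen_eq] apply. *)
Lemma ideal_of_inj L1 L2 : lst L1 -> lst L2 -> idl L1 = idl L2 -> L1 = L2.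
Proof.
move=> lst1 lst2 eqI.
have [w [mu [exp1 res1 tor1]]] := listed_exps lst1.
have [w' [mu' [exp2 res2 tor2]]] := listed_exps lst2.
rewrite -eqI in res2 tor2.
rewrite (residue_exp_inj res2 res1) (torsion_exp_inj tor2 tor1) in exp2.
have bound L u : lst L -> label_gen L = Some u -> label_exps L w mu ->
    (0 < w < q)%N.
  case: u => -[w1 t1] G1 lstL genL expL.
  have [m [_ _ + _ _]] := listed_gen3 lstL genL.
  by case: L lstL genL expL => //= [w2 t2 G2|w2 t2 G2 m2] _ [-> _ _] [->].
have gen_exp L u : lst L -> label_gen L = Some u -> label_exps L w mu -> u.1.1 = w.
  by case: L => //= [w2 t2 G2|w2 t2 G2 m2] _ [<-] [->].
case gen1: (label_gen L1) => [u1|]; case gen2: (label_gen L2) => [u2|].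
- have := gen_exp _ _ lst1 gen1 exp1; have := gen_exp _ _ lst2 gen2 exp2.
  case: u1 u2 gen1 gen2 => -[w1 t1] G1 [[w2 t2] G2] /= gen1 gen2 eq2 eq1.
  rewrite {}eq1 {}eq2 in gen1 gen2.
  have [m1 [_ tor1' _ I1 adm1]] := listed_gen3 lst1 gen1.
  have [m2 [_ tor2' _ I2 adm2]] := listed_gen3 lst2 gen2.
  rewrite -eqI in tor2' I2; rewrite (torsion_exp_inj tor2' tor1') in adm2.
  have [eq_t eq_G] := gen3_uniq (label_ideal L1) tor1' I1 I2 adm1 adm2.
  by rewrite -eq_t -eq_G in gen2; apply: label_gen_eq gen1 gen2.
- have := bound _ _ lst1 gen1 exp1.
  by case: L2 gen2 exp2 {lst2 eqI} => //= [||tau] _ [-> _]; rewrite ?ltnn ?andbF.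
- have := bound _ _ lst2 gen2 exp2.
  by case: L1 gen1 exp1 {lst1 eqI res1 tor1 res2 tor2}
    => //= [||tau] _ [-> _]; rewrite ?ltnn ?andbF.
case: L1 L2 gen1 gen2 lst1 lst2 exp1 exp2 {eqI res1 tor1 res2 tor2}
  => [||t1|//|//] [||t2|//|//] //= _ _.
- by move=> _ _ [-> _] [eq_q0 _]; move: q_gt0; rewrite eq_q0.
- by move=> _ lt_t2 [_ ->] [_ eq_q]; move: lt_t2; rewrite eq_q ltnn.
- by move=> _ _ [-> _] [eq_q0 _]; move: q_gt0; rewrite -eq_q0.
- by move=> _ _ [-> _] [eq_q0 _]; move: q_gt0; rewrite -eq_q0.
- by move=> lt_t1 _ [_ ->] [_ eq_q]; move: lt_t1; rewrite eq_q ltnn.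
- by move=> _ _ [-> _] [eq_q0 _]; move: q_gt0; rewrite eq_q0.
by move=> _ _ [_ <-] [_ <-].
Qed.

Lemma gen2_not_monic tau : gen2 gamma f tau \isn't monic.
Proof.
rewrite monicE /gen2 -mul_polyC lead_coef_Mmonic ?monic_exp // lead_coefC.
apply: contra_neqN gamma_neq0 => /eqP gamma1.
by rewrite -[LHS]mulr1 -[X in _ * X]gamma1 -expr2.
Qed.

(** The [b - t] digits of [G] give [f ^+ t * G] a degree below that of
    [f ^+ b]. *)
Lemma gen3_monic w t G b : (b <= w)%N -> admissible T f k b t G ->
  gen3 gamma f w t G \is monic.
Proof.
move=> le_bw adm; rewrite monicE /gen3 lead_coefDl.
  by rewrite -monicE monic_exp.
have f_exp i : size (f ^+ i) = (d * i).+1.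
  have size_red : size (red (f ^+ i)) = size (f ^+ i).
    apply: size_map_poly_id0.
    by rewrite (eqP (monic_exp i f_monic)) rmorph1 oner_neq0.
  rewrite /d -size_red_f -size_exp -rmorphXn /= size_red prednK // -size_red.
  by rewrite size_poly_gt0 rmorphXn expf_neq0 // irredp_neq0.
rewrite f_exp ltnS (leq_trans (size_scale_leq _ _)) //.
case: adm => [[-> _]|[_ lt_tb _ [a [aP ->]]]]; first by rewrite mulr0 size_poly0.
rewrite (leq_trans (size_polyMleq _ _)) // f_exp addSn /=.
apply: (@leq_trans (d * t + d * (b - t))).
  rewrite leq_add2l; apply: (leq_trans (size_sum _ _ _)).
  apply/bigmax_leqP => i _; apply: (leq_trans (size_polyMleq _ _)).
  rewrite f_exp addnS /= (@leq_trans (d + d * i)) //.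
    by rewrite leq_add2r; case: (aP i _).
  by rewrite -mulnS leq_mul2l ltn_ord orbT.
by rewrite -mulnDr subnKC ?(ltnW lt_tb) // leq_mul2l le_bw orbT.
Qed.

(** A single generator [a] would differ from the first generator by a factor
    [h] that is a unit: both have residue exponent [w < q], so [fb] cannot
    divide the reduction of [h]. *)
Lemma typeIV_not_principal w t G mu : lst (TypeIV w t G mu) ->
  ~ principal (idl (TypeIV w t G mu)).
Proof.
move=> lstL [a]; set I := idl _ => IE; case: (lstL).
move=> kap [[_ _ kap_min] /andP[/andP[lt_mu le_kap] lt_wq] _].
have [w' [mu' [exps [wI _] _]]] := listed_exps lstL.
case: exps wI => -> _ wI {w' mu'}; rewrite -/I in wI.
have genI : pr (gen3 gamma f w t G) \in I.
  by apply/ideal2P; exists 1, 0; rewrite mul1r mul0r addr0.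
have gen2I : pr (gen2 gamma f mu) \in I.
  by apply/ideal2P; exists 0, 1; rewrite mul1r mul0r add0r.
rewrite IE in genI gen2I wI.
have/ideal1P[h genE] := genI.
have/dvdpP[u def_a] : fb ^+ w %| red (val a) by rewrite wI ?pr_val ?mem_ideal1.
have fh : ~~ (fb %| red (val h)).
  have : pr (gen3 gamma f w t G) = pr (val h * val a) by rewrite rmorphM /= !pr_val.
  move/pr_eq_red; rewrite red_gen3 rmorphM /= def_a.
  have -> : fb ^+ w - red (val h) * (u * fb ^+ w) = fb ^+ w * (1 - red (val h) * u).
    by rewrite mulrBr mulr1 [in RHS]mulrCA [fb ^+ w * u]mulrC.
  rewrite -{1}(subnKC (ltnW lt_wq)) exprD dvdp_mul2l; last first.
    by rewrite expf_neq0 ?(irredp_neq0 f_irr).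
  move=> dvd_1hu.
  apply/negP => fh; have : fb %| 1.
    rewrite -[1](subrK (red (val h) * u)) dvdp_add ?dvdp_mulr //.
    apply: dvdp_trans dvd_1hu; rewrite -[X in X %| _]expr1 dvdp_exp2l //.
    by rewrite subn_gt0.
  by rewrite dvdp1; case: f_irr => fb_gt1 _; rewrite gtn_eqF.
have [b] := iffRL (invertible_pr _) fh; rewrite pr_val => hb.
have/ideal1P[v gen2E] := gen2I.
have : pr (gen2 gamma f mu) \in ideal1 (pr (gen3 gamma f w t G)).
  apply/ideal1P; exists (v * b).
  by rewrite genE gen2E -mulrA; congr (_ * _); rewrite mulrA [b * h]mulrC hb mul1r.
by move/kap_min; rewrite leqNgt lt_mu.
Qed.

End Digits.

End Quotient.
End ChainRing.

(** * The Teichmuller set *)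

Section Teichmuller.
Variables (R : finComNzRingType) (gamma : R) (F : finFieldType).
Variables (pi : {rmorphism R -> F}) (p m : nat) (zeta : R).
Hypotheses (gamma_sqr0 : gamma ^+ 2 = 0).
Hypothesis pi_ker : forall x : R, pi x = 0 <-> x \in ideal1 gamma.
Hypotheses (p_prime : prime p) (card_F : #|F| = (p ^ m)%N).
Hypothesis zeta_order : (p ^ m).-1.-primitive_root zeta.

Local Notation N := (p ^ m).-1.

Let N1E : N.+1 = (p ^ m)%N.
Proof. by rewrite prednK // expn_gt0 (prime_gt0 p_prime). Qed.

(** In [x ^+ p - 1 = (x - 1) * \sum_(i < p) x ^+ i] both factors lie in
    [<gamma>], the second because it reduces to [p%:R = 0]. *)
Lemma expr_char_eq1 x : pi x = 1 -> x ^+ p = 1.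
Proof.
move=> px1; have /pi_ker/ideal1P[u x1E] : pi (x - 1) = 0.
  by rewrite rmorphB rmorph1 px1 subrr.
have charF : p%:R = 0 :> F.
  by apply/eqP; case/andP: (finfield.card_finPcharP card_F p_prime).
have /pi_ker/ideal1P[v sumE] : pi (\sum_(i < p) x ^+ i) = 0.
  rewrite rmorph_sum (eq_bigr (fun=> 1)) => [|i _]; last first.
    by rewrite rmorphXn /= px1 expr1n.
  by rewrite sumr_const card_ord -mulr_natr mul1r charF.
apply/eqP; rewrite -subr_eq0 subrX1 x1E sumE.
by rewrite mulrACA -expr2 gamma_sqr0 mulr0.
Qed.

Lemma pi_zeta_neq0 i : pi (zeta ^+ i) != 0.
Proof.
rewrite rmorphXn expf_neq0 //; apply/eqP => pz0.
have := congr1 pi (prim_expr_order zeta_order).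
rewrite rmorphXn /= pz0 rmorph1 expr0n gtn_eqF ?(prim_order_gt0 zeta_order) //.
by move/esym/eqP; rewrite oner_eq0.
Qed.

(** A power of [zeta] reducing to 1 has order dividing both [p] and
    [p ^ m - 1], which are coprime. *)
Lemma pi_zeta_inj i j : pi (zeta ^+ i) = pi (zeta ^+ j) -> zeta ^+ i = zeta ^+ j.
Proof.
wlog le_ij : i j / (i <= j)%N.
  by move=> wl eq_ij; have [/wl->|/ltnW/wl->] := leqP i j.
rewrite -(subnKC le_ij) exprD rmorphM /= -[LHS]mulr1.
move/(mulfI (pi_zeta_neq0 i))/esym/expr_char_eq1.
rewrite -exprM => /eqP; rewrite -(prim_order_dvd zeta_order) Gauss_dvdl.
  by rewrite (prim_order_dvd zeta_order) => /eqP->; rewrite mulr1.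
have m_gt0 : (0 < m)%N.
  by case: m zeta_order => // /prim_order_gt0; rewrite expn0.
have : coprime N N.+1 by rewrite coprimenS.
by rewrite N1E coprime_pexpr.
Qed.

Lemma teich_inj : {in teich N zeta &, injective pi}.
Proof.
move=> x y /setU1P[->|/imsetP[i _ ->]] /setU1P[->|/imsetP[j _ ->]] //.
- by rewrite rmorph0 => /esym/eqP; rewrite (negPf (pi_zeta_neq0 j)).
- by rewrite rmorph0 => /eqP; rewrite (negPf (pi_zeta_neq0 i)).
exact: pi_zeta_inj.
Qed.

(** By [teich_inj], the reduction of the Teichmuller set has [p ^ m] elements. *)
Lemma teich_surj y : exists2 x, x \in teich N zeta & pi x = y.
Proof.
suff /eqP piT : [set pi x | x in teich N zeta] == setT.
  have : y \in [set pi x | x in teich N zeta] by rewrite piT inE.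
  by case/imsetP => x xT ->; exists x.
have zeta_neq0 : 0 \notin [set zeta ^+ (i : nat) | i : 'I_N].
  by apply/imsetP => -[i _ z0]; have := pi_zeta_neq0 i; rewrite -z0 rmorph0 eqxx.
rewrite eqEcard subsetT cardsT card_F card_in_imset; last exact: teich_inj.
rewrite cardsU1 zeta_neq0 card_imset => [|i j /eqP].
  by rewrite card_ord add1n N1E leqnn.
rewrite (eq_prim_root_expr zeta_order) !modn_small // => /eqP.
exact: val_inj.
Qed.

End Teichmuller.

(** * Classification of the ideals *)

(* [pi] presents the residue field: a surjective ring morphism onto the field
   F whose kernel is the ideal generated by gamma. *)
Theorem theorem3p5 (R : finComNzRingType) (gamma : R) (p m : nat)
    (F : finFieldType) (pi : {rmorphism R -> F}) (zeta : R)
    (n s : nat) (alpha beta lambda alpha0 : R)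
    (r : nat) (f g k : 'I_r -> {poly R}) (j : 'I_r)
    (R_chain : chain_ring R)
    (gamma_max : maximal_ideal (ideal1 gamma))
    (gamma_neq0 : gamma != 0) (gamma_sqr0 : gamma ^+ 2 = 0)
    (pi_surj : forall y : F, exists x : R, pi x = y)
    (pi_ker : forall x : R, pi x = 0 <-> x \in ideal1 gamma)
    (p_prime : prime p) (card_F : #|F| = (p ^ m)%N)
    (zeta_order : (p ^ m).-1.-primitive_root zeta)
    (n_gt0 : (0 < n)%N) (s_gt0 : (0 < s)%N) (co_n_p : coprime n p)
    (alphaT : alpha \in teich (p ^ m).-1 zeta) (alpha_neq0 : alpha != 0)
    (betaT : beta \in teich (p ^ m).-1 zeta)
    (lambdaE : lambda = alpha + gamma * beta)
    (alpha0T : alpha0 \in teich (p ^ m).-1 zeta)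
    (alpha0E : alpha0 ^+ (p ^ s) = alpha)
    (f_prod : 'X^n - alpha0%:P = \prod_(i < r) f i)
    (f_monic : forall i, f i \is monic)
    (f_coprime : forall i1 i2, i1 != i2 -> comaximal (f i1) (f i2))
    (f_basic_irr : forall i, irreducible_poly (map_poly pi (f i)))
    (k_prod : 'X^(n * p ^ s) - lambda%:P = \prod_(i < r) k i)
    (kE : forall i, k i = f i ^+ (p ^ s) + gamma *: g i)
    (k_monic : forall i, k i \is monic)
    (k_coprime : forall i1 i2, i1 != i2 -> comaximal (k i1) (k i2))
    (k_deg : forall i, size (k i) = ((size (f i)).-1 * p ^ s).+1)
    (beta0 : beta = 0) :
  let T := teich (p ^ m).-1 zeta in
  let K := {poly %/ k j} in
  let lst := listed T gamma (p ^ s) (f j) (k j) in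
  let idl := ideal_of gamma (f j) (k j) in
  [/\ (* the ideals of K are exactly the listed ones *)
      forall I : {set K}, is_ideal I <-> exists L, lst L /\ I = idl L,
      (* the listed ideals are distinct *)
      forall L1 L2, lst L1 -> lst L2 -> idl L1 = idl L2 -> L1 = L2,
      (* the generators in Types II and III are non-monic, resp. monic *)
      forall tau, lst (TypeII tau) -> gen2 gamma (f j) tau \isn't monic,
      forall omega t G, lst (TypeIII omega t G) ->
        gen3 gamma (f j) omega t G \is monic &
      (* Type IV ideals are not principal *)
      forall omega t G mu, lst (TypeIV omega t G mu) ->
        ~ principal (idl (TypeIV omega t G mu))].
Proof.
move=> T K lst idl.
have q_gt0 : (0 < p ^ s)%N by rewrite expn_gt0 prime_gt0.
have T0 : 0 \in T by rewrite setU11.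
have T_inj := teich_inj gamma_sqr0 pi_ker p_prime card_F zeta_order.
have T_surj := teich_surj gamma_sqr0 pi_ker p_prime card_F zeta_order.
split.
- move=> I; split=> [I_ideal|[L [_ ->]]]; last exact: label_ideal.
  exact: (ideal_listed gamma_neq0 gamma_sqr0 pi_surj pi_ker q_gt0
    (f_basic_irr j) (k_monic j) (kE j) (f_monic j) T_surj).
- exact: (ideal_of_inj gamma_neq0 gamma_sqr0 pi_surj pi_ker q_gt0
    (f_basic_irr j) (k_monic j) (kE j) (f_monic j) T0 T_inj).
- by move=> tau _; apply: (gen2_not_monic gamma_neq0 gamma_sqr0 (f_monic j)).
- move=> w t G [_ [kap [[le_kap _ _] adm]]].
  exact: (gen3_monic gamma (f_basic_irr j) (f_monic j) le_kap adm).
exact: (typeIV_not_principal gamma_neq0 gamma_sqr0 pi_surj pi_ker q_gt0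
    (f_basic_irr j) (k_monic j) (kE j)).
Qed.
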